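(* There is a function $\gamma:(0,1)\to\mathbb{R}^+$ such that, for every positive measure $\mu$, the real space $L_1(\mu)$ has the approximate hyperplane sum property for $\ell_\infty^4$ (AHSp-$\ell_\infty^4$) with this function $\gamma$. Hence, for every positive measure $\mu$, the pair $(\ell_\infty^4,L_1(\mu))$ has the Bishop-Phelps-Bollobás property for operators (BPBp). Moreover, there is a function $\eta$ such that, for every positive measure $\mu$, the pair $(\ell_\infty^4,L_1(\mu))$ has the BPBp with this function $\eta$.
   Context: All spaces are real. $B_X$, $S_X$, $X^*$ denote the closed unit ball, unit sphere and topological dual of $X$; $L(X,Y)$ is the space of bounded linear operators with the operator norm; $\ell_\infty^4$ is $\mathbb{R}^4$ with the max norm. BPBp: Let $\eta:(0,1)\to\mathbb{R}$ satisfy $0<\eta(\varepsilon)<\varepsilon$. The pair $(X,Y)$ of Banach spaces has the BPBp with the function $\eta$ if for every $0<\varepsilon<1$, every $T\in S_{L(X,Y)}$ and every $x_0\in S_X$ with $\|T(x_0)\|>1-\eta(\varepsilon)$, there exist $u_0\in S_X$ and $S\in S_{L(X,Y)}$ such that $\|S(u_0)\|=1$, $\|u_0-x_0\|<\varepsilon$ and $\|S-T\|<\varepsilon$. The pair has the BPBp if it has it with some such $\eta$. $M_Y^4=\{(y_i)_{i\le 4}\in (B_Y)^4: y_{i_1}-y_{i_2}+y_{i_3}\in B_Y \text{ for all } 1\le i_1<i_2<i_3\le 4\}$. AHSp-$\ell_\infty^4$: Let $\gamma:(0,1)\to\mathbb{R}^+$ satisfy $0<\gamma(\varepsilon)<\varepsilon$.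 $Y$ has the AHSp-$\ell_\infty^4$ with the function $\gamma$ if for every $0<\varepsilon<1$ and every $(y_i)_{i\le 4}\in M_Y^4$: whenever there exist a nonempty $A\subset\{1,2,3,4\}$ and $y^*\in S_{Y^*}$ with $y^*(y_i)>1-\gamma(\varepsilon)$ for each $i\in A$, there exists $(z_i)_{i\le 4}\in M_Y^4$ with $\|z_i-y_i\|<\varepsilon$ for every $i\le 4$ and $\|\sum_{i\in A}z_i\|=|A|$. *)

(* Defs.v *)
From HB Require Import structures.
From mathcomp Require Import all_boot all_order all_algebra.
From mathcomp Require Import all_classical all_reals all_analysis.
From mathcomp Require Import ess_sup_inf measurable_realfun.

Set Implicit Arguments.
Unset Strict Implicit.
Unset Printing Implicit Defensive.

Import Order.TTheory GRing.Theory Num.Theory.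
Import numFieldNormedType.Exports.

Local Open Scope classical_set_scope.
Local Open Scope ring_scope.
Local Open Scope quotient_scope.

(** The library defines the type [LspaceType mu p1] of classes of p-integrable
    functions modulo equality [mu]-almost everywhere, but gives it no algebraic
    or topological structure. We equip it with its normed space structure. The
    operations are those of representatives: see [Lclass_add], [Lclass_scale]
    and [Lclass_norm]. *)
Section Lspace_normedModType.
Context (d : measure_display) (T : measurableType d) (R : realType).
Variables (mu : {measure set T -> \bar R}) (p : \bar R) (p1 : (1 <= p)%E).
Local Notation Lp := (LspaceType mu p1).
Local Notation Lf := (LfunType mu p1).
Implicit Types (F G H : Lp) (f g h : Lf) (a b : R).

HB.instance Definition _ := gen_eqMixin Lp.
HB.instance Definition _ := gen_choiceMixin Lp.

Lemma ae_eq_Lnorm (f g : T -> R) :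
  measurable_fun setT f -> measurable_fun setT g -> f = g %[ae mu] ->
  'N[mu]_p[EFin \o f]%E = 'N[mu]_p[EFin \o g]%E.
Proof.
move=> mf mg fg; rewrite unlock /Lnorm.
case: p p1 => [r r1|_|//]; last first.
  case: ifPn => // _; apply: eq_ess_sup.
  by apply: filterS fg => x /(_ I) /= ->.
have mpow (h : T -> R) : measurable_fun setT h ->
    measurable_fun setT (fun x => (`|(EFin \o h) x| `^ r)%E).
  move=> /measurable_EFinP mh.
  by apply: (measurableT_comp (measurable_poweR r)); exact: measurableT_comp.
congr (_ `^ _)%E; apply: ge0_ae_eq_integral => //.
- exact: mpow.
- exact: mpow.
- by move=> x _; exact: poweR_ge0.
- by move=> x _; exact: poweR_ge0.
- by apply: filterS fg => x /(_ I) /= -> _.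
Qed.

Lemma Lrepr_subproof F : (F : T -> R) \in Lfun mu p.
Proof.
rewrite inE; apply/andP; split; rewrite inE/=.
  exact: (@measurable_funPT _ _ T (measurableTypeR R) (repr (F : aeEqMfun _ _))).
by case: F => ? [[]].
Qed.

Definition Lrepr F : Lf := Lfun_Sub p1 (Lrepr_subproof F).


Section Lclass.
Variable f : Lf.

Let m : {mfun T >-> measurableTypeR R} :=
  HB.pack (f : T -> R) (isMeasurableFun.Build d _ T (measurableTypeR R) f
    (@measurable_funPT _ _ T R f)).

Let c : {mfun_ mu, T >-> measurableTypeR R} := \pi m.

Let cf : (c : T -> R) = f %[ae mu].
Proof.
have /eqmodP/asboolP // : repr c = m %[mod {mfun_ mu, T >-> measurableTypeR R}].
by rewrite reprK.
Qed.

Lemma Lclass_subproof : finite_norm mu p c.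
Proof.
have mc := @measurable_funPT _ _ T (measurableTypeR R) (repr c).
have mf : measurable_fun setT (f : T -> R) by [].
rewrite /finite_norm (ae_eq_Lnorm mc mf cf).
exact: Lfunction_finite.
Qed.

Definition Lclass : Lp :=
  HB.pack c (isFinLebesgue.Build d T R mu p p1 c Lclass_subproof).

Lemma Lclass_ae : (Lclass : T -> R) = f %[ae mu].
Proof. exact: cf. Qed.

End Lclass.

Lemma Lspace_eq F G : (F : T -> R) = G %[ae mu] -> F = G.
Proof.
case: F G => [F [[HF]]] [G [[HG]]] /= FG.
have {}FG : F = G.
  rewrite -[F]reprK -[G]reprK; apply/eqmodP/asboolP.
  exact: FG.
by subst G; rewrite (Prop_irrelevance HF HG).
Qed.

Lemma Lclass_eq f g : (f : T -> R) = g %[ae mu] -> Lclass f = Lclass g.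
Proof.
move=> fg; apply: Lspace_eq.
apply: ae_eq_trans (Lclass_ae f) _; apply: ae_eq_trans fg _.
exact/ae_eq_sym/Lclass_ae.
Qed.

Lemma LreprK : cancel Lrepr Lclass.
Proof. by move=> F; apply: Lspace_eq; exact: Lclass_ae. Qed.

Definition Lspace_zero : Lp := Lclass 0.
Definition Lspace_opp F : Lp := Lclass (- Lrepr F).
Definition Lspace_add F G : Lp := Lclass (Lrepr F + Lrepr G).
Definition Lspace_scale a F : Lp := Lclass (a *: Lrepr F).
Definition Lspace_norm F : R := fine ('N[mu]_p[EFin \o F])%E.

Lemma Lspace_addE f g : Lspace_add (Lclass f) (Lclass g) = Lclass (f + g).
Proof.
apply: Lclass_eq; move: (Lclass_ae f) (Lclass_ae g).
by apply: filterS2 => x fx gx _; exact: (congr2 +%R (fx I) (gx I)).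
Qed.

Lemma Lspace_scaleE a f : Lspace_scale a (Lclass f) = Lclass (a *: f).
Proof.
apply: Lclass_eq; move: (Lclass_ae f).
by apply: filterS => x fx _; exact: (congr1 ( *%R a) (fx I)).
Qed.

Lemma Lspace_oppE f : Lspace_opp (Lclass f) = Lclass (- f).
Proof.
apply: Lclass_eq; move: (Lclass_ae f).
by apply: filterS => x fx _; exact: (congr1 -%R (fx I)).
Qed.

Lemma Lspace_normE f : Lspace_norm (Lclass f) = fine ('N[mu]_p[EFin \o f])%E.
Proof.
congr fine; apply: ae_eq_Lnorm (Lclass_ae f) => //.
by have := LfunP (Lrepr (Lclass f)); rewrite inE => /andP[/[!inE]].
Qed.

Lemma Lspace_ind (P : Lp -> Prop) : (forall f, P (Lclass f)) -> forall F, P F.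
Proof. by move=> Pf F; rewrite -[F]LreprK. Qed.

Lemma Lspace_addA : associative Lspace_add.
Proof.
elim/Lspace_ind => f; elim/Lspace_ind => g; elim/Lspace_ind => h.
by rewrite !Lspace_addE addrA.
Qed.

Lemma Lspace_addC : commutative Lspace_add.
Proof.
elim/Lspace_ind => f; elim/Lspace_ind => g; by rewrite !Lspace_addE addrC.
Qed.

Lemma Lspace_add0 : left_id Lspace_zero Lspace_add.
Proof. by elim/Lspace_ind => f; rewrite Lspace_addE add0r. Qed.

Lemma Lspace_addN : left_inverse Lspace_zero Lspace_opp Lspace_add.
Proof. by elim/Lspace_ind => f; rewrite Lspace_oppE Lspace_addE addNr. Qed.

HB.instance Definition _ := GRing.isZmodule.Build Lp
  Lspace_addA Lspace_addC Lspace_add0 Lspace_addN.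

Lemma Lspace_scaleA a b F :
  Lspace_scale a (Lspace_scale b F) = Lspace_scale (a * b) F.
Proof. by elim/Lspace_ind: F => f; rewrite !Lspace_scaleE scalerA. Qed.

Lemma Lspace_scale1 : left_id 1 Lspace_scale.
Proof. by elim/Lspace_ind => f; rewrite Lspace_scaleE scale1r. Qed.

Lemma Lspace_scaleDr : right_distributive Lspace_scale +%R.
Proof.
move=> a; elim/Lspace_ind => f; elim/Lspace_ind => g.
by rewrite [_ + _]Lspace_addE !Lspace_scaleE scalerDr -Lspace_addE.
Qed.

Lemma Lspace_scaleDl F : {morph Lspace_scale^~ F : a b / a + b}.
Proof.
move=> a b; elim/Lspace_ind: F => f.
by rewrite !Lspace_scaleE scalerDl -Lspace_addE.
Qed.

HB.instance Definition _ := GRing.Zmodule_isLmodule.Build R Lp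
  Lspace_scaleA Lspace_scale1 Lspace_scaleDr Lspace_scaleDl.

Lemma Lspace_ler_normD F G :
  Lspace_norm (F + G) <= Lspace_norm F + Lspace_norm G.
Proof.
elim/Lspace_ind: F => f; elim/Lspace_ind: G => g.
by rewrite [_ + _ in leLHS]Lspace_addE !Lspace_normE; exact: ler_LnormD.
Qed.

Lemma Lspace_normZ a F : Lspace_norm (a *: F) = `|a| * Lspace_norm F.
Proof.
elim/Lspace_ind: F => f; rewrite [_ *: _]Lspace_scaleE !Lspace_normE.
by rewrite [X in fine X](LnormZ f a) -finite_norm_fine.
Qed.

Lemma Lspace_norm0_eq0 F : Lspace_norm F = 0 -> F = 0.
Proof.
elim/Lspace_ind: F => f; rewrite Lspace_normE => /fine_Lnormr_eq0 f0.
exact: Lclass_eq.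
Qed.

HB.instance Definition _ := Lmodule_isNormed.Build R Lp
  Lspace_ler_normD Lspace_normZ Lspace_norm0_eq0.

Lemma Lclass_add f g : Lclass (f + g) = Lclass f + Lclass g.
Proof. by rewrite -Lspace_addE. Qed.

Lemma Lclass_scale a f : Lclass (a *: f) = a *: Lclass f.
Proof. by rewrite -Lspace_scaleE. Qed.

Lemma Lclass_norm f : `|Lclass f| = fine ('N[mu]_p[EFin \o f])%E.
Proof. exact: Lspace_normE. Qed.

End Lspace_normedModType.
Arguments Lclass {d T R mu p p1} f.

Section BishopPhelpsBollobas.
Context (R : realType).

Definition opnorm (X Y : normedModType R) (f : X -> Y) : R :=
  sup [set `|f x| | x in [set x : X | `|x| <= 1]].

(** [f] is in the unit sphere of L(X, Y). Boundedness is part of the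
    definition because [sup] returns 0 on unbounded sets. For Y = R^o this is
    the unit sphere of the dual of X. *)
Definition unit_operator (X Y : normedModType R) (f : {linear X -> Y}) : Prop :=
  bounded_near f (nbhs (0 : X)) /\ opnorm f = 1.

(** Functions (0, 1) -> R are total functions, constrained on (0, 1) only. *)
Definition admissible_function (h : R -> R) : Prop :=
  forall e, 0 < e < 1 -> 0 < h e < e.

Definition BPBp_with (eta : R -> R) (X Y : normedModType R) : Prop :=
  admissible_function eta /\
  forall e : R, 0 < e < 1 ->
  forall (T : {linear X -> Y}) (x0 : X),
    unit_operator T -> `|x0| = 1 -> `|T x0| > 1 - eta e ->
  exists (u0 : X) (S : {linear X -> Y}),
    [/\ `|u0| = 1, unit_operator S, `|S u0| = 1,
        `|u0 - x0| < e & opnorm (S \- T) < e].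

Definition BPBp (X Y : normedModType R) : Prop :=
  exists eta : R -> R, BPBp_with eta X Y.

Definition M4 (Y : normedModType R) : set ('I_4 -> Y) :=
  [set y | (forall i, `|y i| <= 1) /\
           forall i1 i2 i3 : 'I_4, (i1 < i2 < i3)%N ->
             `|y i1 - y i2 + y i3| <= 1].

Definition AHSp_linfty4_with (gamma : R -> R) (Y : normedModType R) : Prop :=
  admissible_function gamma /\
  forall e : R, 0 < e < 1 ->
  forall y : 'I_4 -> Y, M4 y ->
  forall A : {set 'I_4}, A != finset.set0 ->
    (exists ystar : {linear Y -> R^o},
      unit_operator ystar /\ forall i, i \in A -> ystar (y i) > 1 - gamma e) ->
  exists z : 'I_4 -> Y,
    [/\ M4 z, (forall i, `|z i - y i| < e)
      & `|\sum_(i in A) z i| = #|A|%:R].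

End BishopPhelpsBollobas.

(** Row vectors carry the max norm in the library. *)
Notation linfty4 R := 'rV[R]_4.

Notation L1 mu := (LspaceType1 mu).

(* Main.v *)
(** A vector of [n] integrable functions is a measurable map into R^n. For
    finitely many linear functionals on R^n, refining the orthants by the
    hyperplanes where these functionals vanish gives finitely many cones, and
    Fourier-Motzkin elimination provides finitely many rays [r j] such that
    every [Y] is [\sum_j f j *: r j] with [f j >= 0] and without cancellation:
    [`|u(Y)| = \sum_j f j * `|u(r j)|] for each functional [u]. Hence the L1
    norms of the [u(Y)] depend only on the masses of the [f j], whatever the
    measure, and they can be moved by rescaling the [f j]. Perturbing [Y] is
    thus a problem about points of a compact set of masses, where approximate
    solutions are close to exact ones by compactness, uniformly in the measure.
    An operator from [linfty^4] is such a vector [(T e_i)_i]; after multiplying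
    by the sign of [T x0], norm attainment at [x0] is one more linear
    constraint on the masses. *)
Require Import Defs.
From HB Require Import structures.
From mathcomp Require Import all_boot all_order all_algebra.
From mathcomp Require Import all_classical all_reals all_analysis.
From mathcomp Require Import measurable_realfun lra ring.

Set Implicit Arguments.
Unset Strict Implicit.
Unset Printing Implicit Defensive.

Import Order.TTheory GRing.Theory Num.Theory.
Import numFieldNormedType.Exports.

Local Open Scope classical_set_scope.
Local Open Scope ring_scope.

(** * Dot products of row vectors *)

Definition dotp {R : realType} {n : nat} (u v : 'rV[R]_n) : R :=
  \sum_i u ord0 i * v ord0 i.

Section DotProduct.
Context {R : realType} {n : nat}.
Implicit Types (u v w : 'rV[R]_n) (a : R).

Lemma dotpDr u v w : dotp u (v + w) = dotp u v + dotp u w.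
Proof. by rewrite -big_split; apply: eq_bigr => i _; rewrite mxE mulrDr. Qed.

Lemma dotpZr u a v : dotp u (a *: v) = a * dotp u v.
Proof. by rewrite mulr_sumr; apply: eq_bigr => i _; rewrite mxE mulrCA. Qed.

Lemma dotp_sumr u (I : finType) (w : I -> 'rV[R]_n) :
  dotp u (\sum_i w i) = \sum_i dotp u (w i).
Proof.
by rewrite exchange_big; apply: eq_bigr => k _; rewrite summxE mulr_sumr.
Qed.

Lemma dotp_delta i v : dotp (delta_mx ord0 i) v = v ord0 i.
Proof.
rewrite /dotp (bigD1 i)//= mxE !eqxx mul1r big1 ?addr0// => j /negPf ji.
by rewrite mxE ji mul0r.
Qed.

End DotProduct.

(** * Ray decompositions *)

Section FourierMotzkin.
Context {R : realType} {J : finType} (phi c : J -> R).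

Definition FM_pos j : R := (0 < phi j)%R%:R.
Definition FM_neg j : R := (phi j < 0)%R%:R.
Definition FM_pospart : R := \sum_j c j * (FM_pos j * phi j).
Definition FM_negpart : R := \sum_j c j * (FM_neg j * - phi j).
Definition FM_max := Num.max FM_pospart FM_negpart.

(** [phi] vanishes on the ray [inr (j, k)], obtained from a ray [j] where it is
    positive and a ray [k] where it is negative. If [FM_max = 0] then all the
    quotients by it in [FM_coef] have a zero numerator. *)
Definition FM_ray {V : lmodType R} (r : J -> V) (x : J + J * J) : V :=
  match x with
  | inl j => r j
  | inr (j, k) => (FM_pos j * (FM_neg k * - phi k)) *: r j +
                  (FM_neg k * (FM_pos j * phi j)) *: r k
  end.

(** For nonnegative [c], pairing uses up the fraction [FM_negpart / FM_max] of each positive ray and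
    [FM_pospart / FM_max] of each negative one. The side with the smaller total is thus absorbed
    into the pairs, and on the remaining single rays [phi] has one sign. *)
Definition FM_coef (x : J + J * J) : R :=
  match x with
  | inl j => c j * (1 - (FM_pos j * FM_negpart + FM_neg j * FM_pospart) / FM_max)
  | inr (j, k) => c j * c k / FM_max
  end.

(** The pairs with [j] as an entry return to [r j] exactly the share that [FM_coef (inl j)] removes
    from it, whatever the signs of [c]. *)
Lemma FM_sum {V : lmodType R} (r : J -> V) :
  \sum_x FM_coef x *: FM_ray r x = \sum_j c j *: r j.
Proof.
rewrite big_sumType/= (eq_bigr (fun p => FM_coef (inr (p.1, p.2)) *:
  FM_ray r (inr (p.1, p.2)))); last by case.
rewrite -(pair_bigA _ (fun j k => FM_coef (inr (j, k)) *: FM_ray r (inr (j, k))))/=.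
under [X in _ + X]eq_bigr do (under eq_bigr do rewrite scalerDr !scalerA;
  rewrite big_split/= -scaler_suml).
rewrite big_split/= [X in _ + (_ + X)]exchange_big/=.
under [X in _ + (_ + X)]eq_bigr do rewrite -scaler_suml.
rewrite -!big_split/=; apply: eq_bigr => j _.
rewrite -!scalerDl; congr (_ *: _).
have -> : \sum_k c j * c k / FM_max * (FM_pos j * (FM_neg k * - phi k)) =
    c j / FM_max * FM_pos j * FM_negpart.
  by rewrite mulr_sumr; apply: eq_bigr => k _; ring.
have -> : \sum_k c k * c j / FM_max * (FM_neg j * (FM_pos k * phi k)) =
    c j / FM_max * FM_neg j * FM_pospart.
  by rewrite mulr_sumr; apply: eq_bigr => k _; ring.
by ring.
Qed.

Hypothesis c0 : forall j, 0 <= c j.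

Lemma FM_posphi j : FM_pos j * phi j = Num.max (phi j) 0.
Proof. by rewrite /FM_pos; case: (ltgtP 0 (phi j)); rewrite ?mul1r ?mul0r. Qed.

Lemma FM_negphi j : FM_neg j * - phi j = Num.max (- phi j) 0.
Proof.
rewrite /FM_neg; case: (ltgtP (phi j) 0) => h; rewrite ?mul1r ?mul0r//.
- by rewrite max_l// oppr_ge0 ltW.
- by rewrite max_r// oppr_le0 ltW.
- by rewrite max_r// h oppr0.
Qed.

Lemma FM_pospart_ge0 : 0 <= FM_pospart.
Proof. by apply: sumr_ge0 => j _; rewrite mulr_ge0// FM_posphi le_max lexx orbT. Qed.

Lemma FM_negpart_ge0 : 0 <= FM_negpart.
Proof. by apply: sumr_ge0 => j _; rewrite mulr_ge0// FM_negphi le_max lexx orbT. Qed.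

Lemma FM_max_ge0 : 0 <= FM_max.
Proof. by rewrite le_max FM_pospart_ge0. Qed.

Lemma FM_coef_ge0 x : 0 <= FM_coef x.
Proof.
case: x => [j|[j k]]/=; last by rewrite !mulr_ge0// invr_ge0 FM_max_ge0.
rewrite mulr_ge0// subr_ge0.
have [m0|m0] := eqVneq FM_max 0; first by rewrite m0 invr0 mulr0.
rewrite ler_pdivrMr ?lt_def ?m0 ?FM_max_ge0// mul1r.
rewrite /FM_pos /FM_neg; case: ltgtP => _; rewrite ?mul1r ?mul0r ?addr0 ?add0r.
- by rewrite le_max lexx orbT.
- by rewrite le_max lexx.
- exact: FM_max_ge0.
Qed.

(** Pairs contribute nothing, and among the single rays only the side with the larger part can keep
    weight; what it keeps totals the difference of the two parts. *)
Lemma FM_sum_norm :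
  \sum_x FM_coef x * `|FM_ray (phi : J -> R^o) x| = `|\sum_j c j * phi j|.
Proof.
have pn : \sum_j c j * phi j = FM_pospart - FM_negpart.
  rewrite -sumrB; apply: eq_bigr => j _; rewrite -mulrBr; congr (_ * _).
  by rewrite /FM_pos /FM_neg; case: ltgtP => [h|h|<-]; rewrite ?mul1r ?mul0r; ring.
rewrite big_sumType/= [X in _ + X]big1 ?addr0; last first.
  move=> [j k] _ /=; rewrite (_ : _ + _ = 0) ?normr0 ?mulr0//.
  by rewrite /GRing.scale/=; ring.
have -> : \sum_j FM_coef (inl j) * `|phi j| =
   FM_pospart * (1 - FM_negpart / FM_max) + FM_negpart * (1 - FM_pospart / FM_max).
  set x := 1 - _; set y := 1 - _.
  rewrite !mulr_suml -big_split/=; apply: eq_bigr => j _.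
  rewrite -!mulrA -mulrDr; congr (_ * _); rewrite {}/x {}/y /FM_pos /FM_neg.
  case: ltgtP => [h|h|<-]; rewrite ?mul1r ?mul0r ?add0r ?addr0.
  - by rewrite gtr0_norm// mulrC.
  - by rewrite ltr0_norm// mulrC.
  - by rewrite normr0 mulr0.
rewrite pn /FM_max; have p0 := FM_pospart_ge0; have n0 := FM_negpart_ge0.
have [pn1|pn1] := leP FM_pospart FM_negpart.
- have [n1|n1] := eqVneq FM_negpart 0.
    by rewrite n1 (_ : FM_pospart = 0) ?subrr ?normr0 ?mul0r ?addr0//; lra.
  by rewrite divff// subrr mulr0 add0r ler0_norm; [field|lra].
- have p1 : FM_pospart != 0 by rewrite gt_eqF//; lra.
  by rewrite divff// subrr mulr0 addr0 ger0_norm; [field|lra].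
Qed.

(** New rays are nonnegative combinations of old ones, so the triangle inequality applies ray by
    ray. Functionals treated earlier therefore stay free of cancellation. *)
Lemma FM_sum_norm_le (psi : J -> R) :
  \sum_x FM_coef x * `|FM_ray (psi : J -> R^o) x| <= \sum_j c j * `|psi j|.
Proof.
(* [FM_sum], with the scalars [|psi j|] as rays, turns the right side into a sum over the new
   rays. *)
rewrite -(FM_sum (fun j => `|psi j| : R^o)); apply: ler_sum => x _.
apply: ler_wpM2l; first exact: FM_coef_ge0.
case: x => [//|[j k]]/=; apply: le_trans (ler_normD _ _) _.
rewrite (@normrZ _ R^o _ (psi j)) (@normrZ _ R^o _ (psi k)) /=.
have jk0 : 0 <= FM_pos j * (FM_neg k * - phi k).
  by rewrite mulr_ge0 ?ler0n// FM_negphi le_max lexx orbT.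
have kj0 : 0 <= FM_neg k * (FM_pos j * phi j).
  by rewrite mulr_ge0 ?ler0n// FM_posphi le_max lexx orbT.
by rewrite (ger0_norm jk0) (ger0_norm kj0).
Qed.

End FourierMotzkin.

Lemma measurable_invr d (T : measurableType d) (R : realType) (h : T -> R) :
  measurable_fun setT h -> (forall t, 0 <= h t) ->
  measurable_fun setT (fun t => (h t)^-1).
Proof.
(* The inverse of a nonnegative number is its power -1, also at 0, where both are 0. *)
move=> mh h0; rewrite (_ : (fun t => _) = (fun t => h t `^ (-1))).
  exact: (measurableT_comp (measurable_powR (-1))).
by apply/funext => t; rewrite powR_inv1.
Qed.

(** Each functional of [Phi] keeps a constant sign on the rays [r j] with
    [f j t != 0], so that its absolute value is linear in the coefficients. *)
Lemma ray_decomposition (R : realType) (n : nat) (Phi : seq 'rV[R]_n) :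
  exists (J : finType) (r : J -> 'rV[R]_n),
  forall d (T : measurableType d) (Y : T -> 'rV[R]_n),
    (forall i, measurable_fun setT (fun t => Y t ord0 i)) ->
  exists f : J -> T -> R,
    [/\ forall j, measurable_fun setT (f j),
        forall j t, 0 <= f j t,
        forall t, Y t = \sum_j f j t *: r j
      & forall u, u \in Phi -> forall t,
          \sum_j f j t * `|dotp u (r j)| <= `|dotp u (Y t)|].
Proof.
elim: Phi => [|w Phi [J [r IH]]].
  (* With no functional to respect, the rays are the signed basis vectors and the coefficients are
     the positive and negative parts of the coordinates. *)
  exists ('I_n * bool)%type,
    (fun ib => (if ib.2 then 1 else -1) *: delta_mx ord0 ib.1).
  move=> d T Y mY.
  exists (fun ib t => Num.max (if ib.2 then Y t ord0 ib.1 else - Y t ord0 ib.1) 0).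
  split => //.
  - move=> [i []]/=; first exact: measurable_maxr.
    by apply: measurable_maxr => //; exact: measurable_funN.
  - by move=> j t; rewrite le_max lexx orbT.
  - move=> t; rewrite -(pair_bigA _ (fun (i : 'I_n) (b : bool) =>
      Num.max (if b then Y t ord0 i else - Y t ord0 i) 0 *:
      ((if b then 1 else -1) *: delta_mx ord0 i)))/=.
    rewrite [LHS]row_sum_delta; apply: eq_bigr => i _.
    rewrite big_bool/= !scalerA -scalerDl; congr (_ *: _).
    by rewrite /Order.max; case: ltP => ?; case: ltP => ?; lra.
exists (J + J * J)%type, (FM_ray (fun j => dotp w (r j)) r) => d T Y mY.
have [f [mf f0 Yf fPhi]] := IH d T Y mY.
pose phi j := dotp w (r j).
exists (fun x t => FM_coef phi (f ^~ t) x); split.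
- have mp : measurable_fun setT (fun t => FM_pospart phi (f ^~ t)).
    by apply: measurable_sum => i; exact: measurable_funM.
  have mn : measurable_fun setT (fun t => FM_negpart phi (f ^~ t)).
    by apply: measurable_sum => i; exact: measurable_funM.
  have mm : measurable_fun setT (fun t => (FM_max phi (f ^~ t))^-1).
    apply: measurable_invr; first exact: measurable_maxr.
    by move=> t; apply: FM_max_ge0.
  move=> [j|[j k]]/=.
    apply: measurable_funM => //; apply: measurable_funB => //.
    apply: measurable_funM => //; apply: measurable_funD; exact: measurable_funM.
  by apply: measurable_funM => //; exact: measurable_funM.
- by move=> x t; exact: FM_coef_ge0.
- by move=> t; rewrite FM_sum.
have rayE u x : dotp u (FM_ray phi r x) = FM_ray phi (fun j => dotp u (r j) : R^o) x.
  by case: x => [//|[j k]]; rewrite /FM_ray dotpDr !dotpZr.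
(* The new functional [w] gets an equality from [FM_sum_norm]; those of [Phi] keep the bound of the
   induction hypothesis. *)
move=> u; rewrite inE => /predU1P[-> t|uPhi t].
  under eq_bigr do rewrite rayE; rewrite FM_sum_norm// Yf dotp_sumr.
  by under [in leRHS]eq_bigr do rewrite dotpZr.
apply: le_trans (fPhi u uPhi t); under eq_bigr do rewrite rayE.
exact: FM_sum_norm_le.
Qed.

(** * Vectors of integrable functions *)

Section L1Space.
Context d (T : measurableType d) (R : realType) (mu : {measure set T -> \bar R}).
Local Notation Lf := (LfunType mu (@lexx _ _ 1%E)).
Local Notation L1mu := (L1 mu).

Lemma Lclass_sum (I : finType) (a : I -> R) (h : I -> Lf) :
  Lclass (\sum_i a i *: h i) = \sum_i a i *: (Lclass (h i) : L1mu).
Proof.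
elim/big_rec2: _ => [//|i x f _ <-].
by rewrite Lclass_add Lclass_scale.
Qed.

Lemma Lfun_sumE (I : finType) (a : I -> R) (h : I -> Lf) t :
  (\sum_i a i *: h i : Lf) t = \sum_i a i * h i t.
Proof.
by elim/big_rec2: _ => [//|i x f _ <-].
Qed.

Lemma Lfun_int (f : Lf) : mu.-integrable setT (EFin \o f).
Proof. by apply/Lfun1_integrable; exact: LfunP. Qed.

Lemma L1_norm (f : Lf) : `|Lclass f : L1mu| = (\int[mu]_t `|f t|)%R.
Proof. by rewrite Lclass_norm Lnorm1. Qed.

Lemma sum_norm_int (I : finType) (a : I -> R) (w : I -> Lf) :
  mu.-integrable setT (EFin \o (fun t => \sum_i a i * `|w i t|)) /\
  \sum_i a i * `|Lclass (w i) : L1mu| = (\int[mu]_t \sum_i a i * `|w i t|)%R.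
Proof.
have iw i : mu.-integrable setT (EFin \o (fun t => `|w i t|)).
  exact/integrable_norm/Lfun_int.
have iaw i : mu.-integrable setT (EFin \o (fun t => a i * `|w i t|)).
  by apply: eq_integrable (integrableZl _ (a i) (iw i)).
elim: (index_enum I) => [|i s [IH1 IH2]].
  split.
    apply: eq_integrable (integrable0 mu setT) => // t _ /=.
    by rewrite big_nil.
  rewrite big_nil; under [RHS]eq_Rintegral do rewrite big_nil.
  by rewrite /Rintegral integral0.
split.
  apply: eq_integrable (integrableD _ (iaw i) IH1) => // t _ /=.
  by rewrite big_cons.
rewrite big_cons IH2 L1_norm -RintegralZl// -RintegralD//.
by apply: eq_Rintegral => t _; rewrite big_cons.
Qed.

End L1Space.

(** The [G j] carry the pointwise sign of [\sum_i x i *: y i], so that the third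
    clause linearizes its norm. *)
Lemma L1_ray_decomposition (R : realType) (n : nat) (Phi : seq 'rV[R]_n) :
  exists (J : finType) (r : J -> 'rV[R]_n) (C : R),
  forall d (T : measurableType d) (mu : {measure set T -> \bar R})
    (y : 'I_n -> L1 mu) (x : 'rV[R]_n),
  exists G : J -> L1 mu,
    [/\ forall i, y i = \sum_j r j ord0 i *: G j,
        forall u, u \in Phi ->
          \sum_j `|dotp u (r j)| * `|G j| <= `|\sum_i u ord0 i *: y i|,
        `|\sum_i x ord0 i *: y i| <= \sum_j dotp x (r j) * `|G j|,
        forall a : J -> R, \sum_j a j * `|G j| <= `|\sum_j a j *: G j|
      & (forall i, `|y i| <= 1) -> forall j, `|G j| <= C].
Proof.
(* The coordinate functionals are added to [Phi] so that each coefficient on a nonzero ray is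
   dominated by some [|Y i|]. This gives integrability and the bound [C]. *)
have [J [r rP]] :=
  ray_decomposition (Phi ++ [seq delta_mx ord0 i | i <- enum 'I_n]).
(* The sum dominates every single [|r j ord0 i|^-1]; zero coordinates contribute 0. *)
exists J, r, (\sum_j \sum_i `|r j ord0 i|^-1) => d T mu y x.
pose Y i := Lrepr (y i).
have mY i : measurable_fun setT (Y i) by [].
pose xY t := \sum_i x ord0 i * Y i t.
(* The sign of [xY t], set to 1 at zeros so that [g t * g t = 1] everywhere. *)
pose g t : R := if 0 <= xY t then 1 else -1.
have mg : measurable_fun setT g.
  apply: measurable_fun_ifT => //; apply: measurable_fun_ler => //.
  by apply: measurable_sum => i; exact: measurable_funM.
have gg t : g t * g t = 1 by rewrite /g; case: ifP => _; rewrite ?mulrNN mulr1.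
have g1 t : `|g t| = 1 by rewrite /g; case: ifP => _; rewrite ?normrN normr1.
have [|f [mf f0 Yf fPhi]] := rP d T (fun t => \row_i (g t * Y i t)).
  move=> i; rewrite (_ : (fun t => _) = (fun t => g t * Y i t)).
    exact: measurable_funM.
  by apply/funext => t; rewrite mxE.
have dotY u t : dotp u (\row_i (g t * Y i t)) = g t * \sum_i u ord0 i * Y i t.
  rewrite mulr_sumr; apply: eq_bigr => i _; rewrite mxE; ring.
have fcoord j i t : f j t * `|r j ord0 i| <= `|Y i t|.
  have := fPhi (delta_mx ord0 i); rewrite mem_cat map_f ?mem_enum ?orbT//.
  move=> /(_ erefl t); rewrite dotp_delta mxE normrM g1 mul1r; apply: le_trans.
  rewrite (bigD1 j)//= dotp_delta lerDl sumr_ge0// => k _.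
  by rewrite mulr_ge0.
(* No coordinate controls the coefficient of a zero ray, which may fail to be integrable; [k j]
   replaces it by 0 without changing the sum. *)
pose k j : R := (r j != 0)%:R.
have kr j : k j *: r j = r j.
  by rewrite /k; case: eqVneq => [->|]; rewrite ?scaler0 ?scale1r.
have r0P j : r j != 0 -> exists i, r j ord0 i != 0.
  move=> rj; apply/existsP; apply: contraNT rj; rewrite negb_exists => /forallP rj.
  by apply/eqP/rowP => i; rewrite mxE; apply/eqP/negPn/rj.
have wL j : (fun t => k j * (g t * f j t)) \in Lfun mu 1.
  apply/Lfun1_integrable.
  have mkgf : measurable_fun setT (fun t => k j * (g t * f j t)).
    by apply: measurable_funM => //; exact: measurable_funM.
  have [rj|/r0P[i ri]] := eqVneq (r j) 0.
    apply: eq_integrable (integrable0 mu setT) => // t _ /=.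
    by rewrite /k rj eqxx mul0r.
  have := integrableZl measurableT `|r j ord0 i|^-1 (integrable_norm (Lfun_int (Y i))).
  apply: le_integrable => //; first exact/measurable_EFinP.
  move=> t _ /=; rewrite lee_fin normrM normr_nat normrM g1 mul1r.
  rewrite (ger0_norm (f0 j t)) [leRHS]ger0_norm ?mulr_ge0 ?invr_ge0//.
  rewrite ler_pdivlMl ?normr_gt0// mulrCA mulrC.
  rewrite (le_trans _ (fcoord j i t))// mulrC [leRHS]mulrC ler_piMl//.
    by rewrite mulr_ge0.
  by rewrite lern1 leq_b1.
pose w j := Lfun_Sub (@lexx _ _ 1%E) (wL j).
have wE j t : w j t = k j * (g t * f j t) by [].
have wnE j t : `|w j t| = k j * f j t.
  by rewrite wE !normrM g1 mul1r !ger0_norm// ler0n.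
have Yw i t : Y i t = \sum_j r j ord0 i * w j t.
  transitivity (g t * (g t * Y i t)); first by rewrite mulrA gg mul1r.
  have /rowP/(_ i) := Yf t; rewrite mxE => ->.
  rewrite summxE mulr_sumr; apply: eq_bigr => j _; rewrite mxE wE.
  by rewrite -[in LHS](kr j) mxE; ring.
have wg j t : w j t = g t * `|w j t| by rewrite wnE wE; ring.
have dotYw (u : 'rV[R]_n) t : \sum_i u ord0 i * Y i t = \sum_j dotp u (r j) * w j t.
  under eq_bigr do rewrite Yw mulr_sumr; rewrite exchange_big/=.
  by apply: eq_bigr => j _; rewrite mulr_suml; apply: eq_bigr => i _; rewrite mulrA.
have yE (u : 'rV[R]_n) : \sum_i u ord0 i *: y i = Lclass (\sum_i u ord0 i *: Y i).
  by rewrite Lclass_sum; apply: eq_bigr => i _; rewrite LreprK.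
have norm_int (h : LfunType mu (@lexx _ _ 1%E)) :
    mu.-integrable setT (EFin \o (fun t => `|h t|)).
  exact/integrable_norm/Lfun_int.
have coord : forall u, u \in Phi ++ [seq delta_mx ord0 i | i <- enum 'I_n] ->
    \sum_j `|dotp u (r j)| * `|Lclass (w j)| <= `|\sum_i u ord0 i *: y i|.
  move=> u uPhi; rewrite yE L1_norm.
  have [iw ->] := sum_norm_int (fun j => `|dotp u (r j)|) w.
  apply: le_Rintegral => // t _; rewrite Lfun_sumE.
  have := fPhi u uPhi t; rewrite dotY normrM g1 mul1r; apply: le_trans.
  apply: ler_sum => j _; rewrite wnE mulrA mulrC.
  by rewrite -{2}(kr j) dotpZr normrM [`|k j|]ger0_norm ?ler0n// [k j * _]mulrC.
exists (fun j => Lclass (w j)); split.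
- move=> i; rewrite -Lclass_sum -[LHS]LreprK; apply: Lclass_eq; apply: aeW => t _.
  by rewrite Lfun_sumE Yw.
- by move=> u uPhi; apply: coord; rewrite mem_cat uPhi.
- rewrite yE L1_norm.
  have [iw ->] := sum_norm_int (fun j => dotp x (r j)) w.
  apply: le_Rintegral => // t _; rewrite Lfun_sumE.
  have -> : `|\sum_i x ord0 i * Y i t| = g t * xY t.
    rewrite /g -/(xY t); case: leP => h; first by rewrite ger0_norm// mul1r.
    by rewrite ltr0_norm// mulN1r.
  rewrite /xY dotYw mulr_sumr; apply: ler_sum => j _.
  by rewrite {1}wg mulrCA (mulrA (g t)) gg mul1r.
(* All [w j] share the sign [g], so a combination of them equals [g] times the same combination of
   their absolute values. *)
- move=> a; rewrite -Lclass_sum L1_norm.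
  have [iw ->] := sum_norm_int a w.
  apply: le_Rintegral => // t _; rewrite Lfun_sumE.
  under [in leRHS]eq_bigr do rewrite wg mulrCA.
  by rewrite -mulr_sumr normrM g1 mul1r ler_norm.
- move=> y1 j; have [rj|/r0P[i ri]] := eqVneq (r j) 0.
    rewrite (_ : Lclass (w j) = 0); last first.
      by apply: Lclass_eq; apply: aeW => t _; rewrite wE /k rj eqxx mul0r.
    by rewrite normr0; do 2 (apply: sumr_ge0 => ? _); rewrite invr_ge0.
  have : \sum_j `|r j ord0 i| * `|Lclass (w j)| <= 1.
    apply: le_trans (y1 i); have := coord (delta_mx ord0 i).
    rewrite mem_cat map_f ?mem_enum ?orbT// => /(_ erefl).
    rewrite [X in `|X|](_ : _ = y i).
      by under eq_bigr do rewrite dotp_delta.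
    rewrite (bigD1 i)//= mxE !eqxx scale1r big1 ?addr0// => l /negPf li.
    by rewrite mxE li scale0r.
  rewrite (bigD1 j)//= => h.
  have {h} : `|r j ord0 i| * `|Lclass (w j)| <= 1.
    by apply: le_trans h; rewrite lerDl sumr_ge0// => ? _; rewrite mulr_ge0.
  rewrite mulrC -ler_pdivlMr ?normr_gt0// mul1r => /le_trans; apply.
  rewrite (bigD1 j)//= (bigD1 i)//= -addrA lerDl.
  by rewrite addr_ge0 ?sumr_ge0// => *; rewrite ?sumr_ge0// => *; rewrite invr_ge0.
Qed.

(** * Compactness *)

Lemma continuous_sumr (R : realType) (U : topologicalType) (I : finType)
    (F : I -> U -> R) :
  (forall i, continuous (F i)) -> continuous (fun p => \sum_i F i p).
Proof. by move=> cF; apply: continuous_big => //; exact: add_continuous. Qed.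

Lemma continuous_mulr (R : realType) (U : topologicalType) (f g : U -> R) :
  continuous f -> continuous g -> continuous (fun p => f p * g p).
Proof. by move=> cf cg p; apply: cvgM; [exact: cf|exact: cg]. Qed.

Lemma closed_le_continuous (R : realType) (U : topologicalType) (f : U -> R) a :
  continuous f -> closed [set p | f p <= a].
Proof.
move=> cf; apply: (@preimage_closed _ _ f [set x | x <= a]) => [p _|].
  exact: cf.
exact: closed_le.
Qed.

Lemma closed_ge_continuous (R : realType) (U : topologicalType) (f : U -> R) a :
  continuous f -> closed [set p | a <= f p].
Proof.
move=> cf; apply: (@preimage_closed _ _ f [set x | a <= x]) => [p _|].
  exact: cf.
exact: closed_ge.
Qed.

Lemma rV_coord_le (R : realType) (n : nat) (v : 'rV[R]_n) i :
  `|v ord0 i| <= `|v|.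
Proof.
rewrite [leRHS]mx_normrE.
exact: (le_bigmax _ (fun k : 'I_1 * 'I_n => `|v k.1 k.2|) (ord0, i)).
Qed.

(** Admissible pairs of masses and [x] form a compact set. Those at distance at least [e] from all
    exact solutions form a compact subset on which the constraint is strictly below 1; its maximum
    there leaves the gap [gamma]. *)
Lemma mass_perturbation (R : realType) (n : nat) (J : finType)
    (r : J -> 'rV[R]_n) (Phi : seq 'rV[R]_n) (C : R) (K : set 'rV[R]_n) :
  compact K -> forall e : R, 0 < e -> exists2 gamma : R, 0 < gamma &
  forall (m : J -> R) x, K x -> (forall j, 0 <= m j <= C) ->
    (forall u, u \in Phi -> \sum_j `|dotp u (r j)| * m j <= 1) ->
    1 - gamma < \sum_j dotp x (r j) * m j ->
  exists (m' : J -> R) (x' : 'rV[R]_n), [/\ K x', forall j, 0 <= m' j,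
      forall u, u \in Phi -> \sum_j `|dotp u (r j)| * m' j <= 1,
      1 <= \sum_j dotp x' (r j) * m' j
    & (forall j, `|m' j - m j| < e) /\ `|x' - x| < e].
Proof.
move=> cK e e0.
pose P := ('rV[R]_#|J| * 'rV[R]_n)%type.
pose mass (p : P) j := p.1 ord0 (enum_rank j).
have cmass j : continuous (mass ^~ j).
  move=> p; apply: (@continuous_comp _ _ _ fst
    (fun v : 'rV_#|J| => v ord0 (enum_rank j))).
    exact: cvg_fst.
  exact: coord_continuous.
have ccoord i : continuous (fun p : P => p.2 ord0 i).
  move=> p; apply: (@continuous_comp _ _ _ snd (fun v : 'rV_n => v ord0 i)).
    exact: cvg_snd.
  exact: coord_continuous.
pose L (p : P) := \sum_j dotp p.2 (r j) * mass p j.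
have cL : continuous L.
  apply: continuous_sumr => j; apply: continuous_mulr; last exact: cmass.
  apply: continuous_sumr => i; apply: continuous_mulr; first exact: ccoord.
  by move=> p; exact: cvg_cst.
pose B := ([set v : 'rV[R]_#|J| | forall k, `[0, C]%classic (v ord0 k)] `*` K) `&`
  \bigcap_(u in [set` Phi]) [set p : P | \sum_j `|dotp u (r j)| * mass p j <= 1].
have cB : compact B.
  apply: compact_closedI.
    by apply: compact_setX => //;
      apply: (@rV_compact _ _ (fun=> `[0, C]%classic)) => _; exact: segment_compact.
  apply: closed_bigI => u _; apply: closed_le_continuous.
  apply: continuous_sumr => j; apply: continuous_mulr; last exact: cmass.
  by move=> p; exact: cvg_cst.
(* [F] is the set of exact solutions, [D] the set of admissible points far from all of them. *)
pose F := B `&` [set p | 1 <= L p].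
pose D := B `&` \bigcap_(q in F) [set p : P | e <= `|q - p|].
have cD : compact D.
  apply: compact_closedI => //; apply: closed_bigI => q _.
  apply: closed_ge_continuous => p; apply: cvg_norm.
  by apply: cvgB; [exact: cvg_cst|exact: cvg_id].
have [gamma g0 gP] : exists2 gamma, 0 < gamma & forall p, D p -> L p <= 1 - gamma.
  have [D0|/set0P D0] := eqVneq D set0; first by exists 1 => // p; rewrite D0.
  have [p /set_mem[Bp Dp] pmax] := compact_EVT_max D0 cD (continuous_subspaceT cL).
  exists (1 - L p); last by move=> q /mem_set/pmax; rewrite subKr.
  (* If [L p] reached 1, then [p] would be an exact solution at distance 0 from itself. *)
  rewrite subr_gt0 ltNge; apply/negP => Lp.
  by have := Dp p (conj Bp Lp); rewrite /= subrr normr0 leNgt e0.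
exists gamma => // m x Kx m0C mPhi Lmx.
pose p : P := (\row_k m (enum_val k), x).
have massp j : mass p j = m j by rewrite /mass mxE enum_rankK.
have Bp : B p.
  split; first by split => // k /=; rewrite mxE in_itv/=.
  by move=> u uPhi /=; under eq_bigr do rewrite massp; exact: mPhi.
have : ~ D p.
  move=> /gP; rewrite leNgt => /negP; apply.
  by rewrite /L; under eq_bigr do rewrite massp.
move=> nDp; have [q [Bq Lq] pq] : exists2 q, F q & `|q - p| < e.
  apply: contrapT => h; apply: nDp; split => // q Fq /=.
  by rewrite leNgt; apply/negP => qp; apply: h; exists q.
have [[q1 Kq2] qPhi] := Bq.
move: pq; rewrite prod_normE gt_max => /andP[pq1 pq2].
exists (mass q), q.2; split => //.
- by move=> j; have := q1 (enum_rank j); rewrite /= in_itv/= => /andP[].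
- split=> [j|]; last exact: pq2.
  apply: le_lt_trans pq1; rewrite -massp.
  have -> : mass q j - mass p j = (q.1 - p.1) ord0 (enum_rank j).
    by rewrite [RHS]mxE [X in _ = _ + X]mxE.
  exact: rV_coord_le.
Qed.

(** The norms [|G j|] serve as masses. After they are corrected by [mass_perturbation], rescaling
    the [G j] realizes the new masses: the triangle inequality gives the upper bounds, and the
    common sign gives the lower one. *)
Lemma L1_perturbation (R : realType) (n : nat) (Phi : seq 'rV[R]_n)
    (K : set 'rV[R]_n) :
  compact K -> forall e : R, 0 < e -> exists2 gamma : R, 0 < gamma &
  forall d (T : measurableType d) (mu : {measure set T -> \bar R})
    (y : 'I_n -> L1 mu) (x : 'rV[R]_n),
    K x -> (forall i, `|y i| <= 1) ->
    (forall u, u \in Phi -> `|\sum_i u ord0 i *: y i| <= 1) ->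
    1 - gamma < `|\sum_i x ord0 i *: y i| ->
  exists (z : 'I_n -> L1 mu) (x' : 'rV[R]_n),
    [/\ K x', forall u, u \in Phi -> `|\sum_i u ord0 i *: z i| <= 1,
        1 <= `|\sum_i x' ord0 i *: z i|,
        forall i, `|z i - y i| < e & `|x' - x| < e].
Proof.
move=> cK e e0.
have [J [r [C rP]]] := L1_ray_decomposition Phi.
(* Moving each mass by less than [e / M] moves each [z i] by less than [e]; the summand 1 makes this
   strict and gives [e / M <= e] for [x']. *)
pose M := 1 + \sum_j \sum_i `|r j ord0 i|.
have M1 : 1 <= M by rewrite lerDl; do 2 (apply: sumr_ge0 => ? _).
have M0 : 0 < M by exact: lt_le_trans M1.
have [gamma g0 gP] := mass_perturbation r Phi C cK (divr_gt0 e0 M0).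
(* The cap 1 makes [1 - gamma] nonnegative, so the combination of the [y i] is nonzero and some
   [G k] is nonzero. *)
exists (Num.min gamma 1) => [|d T mu y x Kx y1 yPhi xy]; first by rewrite lt_min g0/=.
have [G [yG GPhi xG aligned GC]] := rP d T mu y x.
have [||||m' [x' [Kx' m'0 m'Phi x'm' [m'm x'x]]]] := gP (fun j => `|G j|) x => //.
- by move=> j; rewrite normr_ge0 GC.
- by move=> u uPhi; apply: le_trans (yPhi u uPhi); exact: GPhi.
- apply: lt_le_trans xG; apply: le_lt_trans xy; rewrite lerB//.
  by rewrite ge_min lexx.
(* A ray of zero mass has no density to rescale; [G k] is used instead. *)
have [k Gk] : exists k, `|G k| != 0.
  apply/existsP; apply: contraTT xG; rewrite negb_exists => /forallP G0.
  rewrite [X in _ <= X]big1 => [|j _].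
    by rewrite -ltNge (le_lt_trans _ xy)// subr_ge0 ge_min lexx orbT.
  by have /negPn/eqP -> := G0 j; rewrite mulr0.
pose kap j := if `|G j| == 0 then k else j.
have Gkap j : `|G (kap j)| != 0 by rewrite /kap; case: ifP => // ->.
pose b j := m' j / `|G (kap j)|.
have bG j : b j * `|G (kap j)| = m' j by rewrite divfK.
pose G' j := b j *: G (kap j).
have nG' j : `|G' j| = m' j by rewrite normrZ ger0_norm ?divr_ge0.
have aligned' (a : J -> R) : \sum_j a j * m' j <= `|\sum_j a j *: G' j|.
  (* Several indices may be sent by [kap] to the same [G l]; their coefficients are added up before
     alignment is applied. *)
  have := aligned (fun l => \sum_(j | kap j == l) a j * b j).
  have -> : \sum_l (\sum_(j | kap j == l) a j * b j) * `|G l| = \sum_j a j * m' j.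
    rewrite [RHS](partition_big kap xpredT)//=; apply: eq_bigr => l _.
    by rewrite mulr_suml; apply: eq_bigr => j /eqP <-; rewrite -mulrA bG.
  congr (_ <= `|_|); rewrite [RHS](partition_big kap xpredT)//=.
  apply: eq_bigr => l _; rewrite scaler_suml; apply: eq_bigr => j /eqP <-.
  by rewrite scalerA.
have G'G j : `|G' j - G j| = `|m' j - `|G j| |.
  have [Gj|Gj] := eqVneq `|G j| 0.
    by rewrite Gj (normr0_eq0 Gj) !subr0 nG' ger0_norm.
  have kapj : kap j = j by rewrite /kap (negPf Gj).
  rewrite -[in LHS](scale1r (G j)) /G' kapj -scalerBl normrZ.
  by rewrite -(bG j) kapj -[X in _ = `|_ - X|]mul1r -mulrBl normrM normr_id.
pose z i := \sum_j r j ord0 i *: G' j.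
have zE (u : 'rV[R]_n) : \sum_i u ord0 i *: z i = \sum_j dotp u (r j) *: G' j.
  under eq_bigr do rewrite scaler_sumr; rewrite exchange_big/=.
  apply: eq_bigr => j _; rewrite scaler_suml; apply: eq_bigr => i _.
  by rewrite scalerA.
exists z, x'; split => //.
- move=> u uPhi; rewrite zE; apply: le_trans (m'Phi u uPhi).
  apply: le_trans (ler_norm_sum _ _ _) _; apply: ler_sum => j _.
  by rewrite normrZ nG'.
- by rewrite zE; apply: le_trans x'm' _; exact: aligned'.
- move=> i; rewrite yG -sumrB; under eq_bigr do rewrite -scalerBr.
  apply: le_lt_trans (ler_norm_sum _ _ _) _.
  apply: (@le_lt_trans _ _ (\sum_j `|r j ord0 i| * (e / M))).
    by apply: ler_sum => j _; rewrite normrZ G'G ler_wpM2l// ltW.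
  rewrite -mulr_suml mulrA ltr_pdivrMr// mulrC ltr_pM2l//.
  apply: (@le_lt_trans _ _ (\sum_j \sum_i `|r j ord0 i|)).
    apply: ler_sum => j _; rewrite (bigD1 i)//= lerDl.
    exact: sumr_ge0.
  by rewrite /M ltrDr.
- by apply: lt_le_trans x'x _; rewrite ler_pdivrMr// ler_peMr// ltW.
Qed.

(** * Operators *)

Lemma opnorm_le (R : realType) (X Y : normedModType R) (f : X -> Y) c :
  (forall x, `|x| <= 1 -> `|f x| <= c) -> opnorm f <= c.
Proof.
move=> fc; apply: ge_sup; first by exists `|f 0|, 0 => //=; rewrite normr0.
by move=> _ [x /= x1 <-]; exact: fc.
Qed.

Lemma unit_operator_le (R : realType) (X Y : normedModType R)
    (f : {linear X -> Y}) : unit_operator f -> forall x, `|f x| <= `|x|.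
Proof.
move=> [/linear_boundedP/pinfty_ex_gt0[r r0 fr] f1] x.
have [->|x0] := eqVneq x 0; first by rewrite linear0 !normr0.
have x0' : 0 < `|x| by rewrite normr_gt0.
have : `|f (`|x|^-1 *: x)| <= 1.
  rewrite -f1; apply: ub_le_sup.
    exists r => _ [u /= u1 <-]; apply: le_trans (fr u) _.
    by rewrite ler_piMr// ltW.
  exists (`|x|^-1 *: x) => //=.
  by rewrite normrZ gtr0_norm ?invr_gt0// mulVf ?normr_eq0.
by rewrite linearZ/= normrZ gtr0_norm ?invr_gt0// ler_pdivrMl// mulr1.
Qed.

Lemma unit_operator_attained (R : realType) (X Y : normedModType R)
    (f : {linear X -> Y}) u :
  (forall x, `|x| <= 1 -> `|f x| <= 1) -> `|u| <= 1 -> `|f u| = 1 ->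
  unit_operator f.
Proof.
move=> f1 u1 fu; split.
  apply/ex_bound; exists 1; apply/nbhs_norm0P; exists 1 => //= x /= /ltW; exact: f1.
apply/eqP; rewrite eq_le opnorm_le//= -[leLHS]fu; apply: ub_le_sup.
  by exists 1 => _ [x /= x1 <-]; exact: f1.
by exists u.
Qed.

(** Choice gives a threshold for each [e]; monotonicity allows cutting it down to at most [e / 2],
    which secures [h e < e]. *)
Lemma exists_admissible (R : realType) (P : R -> R -> Prop) :
  (forall e, 0 < e < 1 -> exists2 g, 0 < g & P e g) ->
  (forall e g g', g' <= g -> P e g -> P e g') ->
  exists h : R -> R, admissible_function h /\ forall e, 0 < e < 1 -> P e (h e).
Proof.
move=> exP monoP.
have /choice[h hP] e : exists g, 0 < e < 1 -> 0 < g /\ P e g.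
  have [/exP[g g0 Pg]|e01] := boolP (0 < e < 1); first by exists g.
  by exists 0.
exists (fun e => Num.min (h e) (e / 2)); split=> e e01; have [he Pe] := hP e e01.
  by rewrite lt_min he gt_min /=; apply/andP; split; [lra|apply/orP; right; lra].
by apply: monoP Pe; rewrite ge_min lexx.
Qed.

Lemma rV_norm_le (R : realType) (n : nat) (v : 'rV[R]_n) (c : R) :
  0 <= c -> (forall i, `|v ord0 i| <= c) -> `|v| <= c.
Proof.
move=> c0 vc; rewrite [leLHS]mx_normrE; apply: bigmax_le => // -[i j] _ /=.
by rewrite ord1.
Qed.

(** A convex function on a cube is bounded by its values at the vertices, so an operator norm bound
    from [linfty^n] amounts to finitely many norm constraints. *)
Lemma cube_norm_le (R : realType) (n : nat) (V : normedModType R)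
    (z : 'I_n -> V) c :
  (forall u : 'rV[R]_n, (forall i, `|u ord0 i| = 1) ->
     `|\sum_i u ord0 i *: z i| <= c) ->
  forall x : 'rV[R]_n, `|x| <= 1 -> `|\sum_i x ord0 i *: z i| <= c.
Proof.
move=> zc x0 x01.
have {x01} : forall i, `|x0 ord0 i| <= 1.
  by move=> i; apply: le_trans x01; exact: rV_coord_le.
have : forall i, i \notin enum 'I_n -> `|x0 ord0 i| = 1 by move=> i; rewrite mem_enum.
(* Move the coordinates of x0 to the endpoints of [-1, 1] one at a time. *)
elim: (enum 'I_n) x0 => [|a D IH] x xD x1; first by apply: zc => i; exact: xD.
pose v s : 'rV[R]_n := \row_i (if i == a then s else x ord0 i).
have vc s : `|s| = 1 -> `|\sum_i v s ord0 i *: z i| <= c.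
  move=> s1; apply: IH => i; rewrite mxE; case: eqVneq => // ia; rewrite ?s1//.
  by move=> iD; apply: xD; rewrite inE negb_or ia.
have -> : \sum_i x ord0 i *: z i =
    ((1 + x ord0 a) / 2) *: (\sum_i v 1 ord0 i *: z i) +
    ((1 - x ord0 a) / 2) *: (\sum_i v (-1) ord0 i *: z i).
  rewrite !scaler_sumr -big_split/=; apply: eq_bigr => i _.
  rewrite !scalerA -scalerDl; congr (_ *: _); rewrite !mxE.
  by case: eqVneq => [->|_]; field.
have := x1 a; rewrite ler_norml => /andP[xa1 xa2].
have xa3 : 0 <= (1 + x ord0 a) / 2 by lra.
have xa4 : 0 <= (1 - x ord0 a) / 2 by lra.
apply: le_trans (ler_normD _ _) _.
rewrite normrZ [X in _ + X]normrZ (ger0_norm xa3) (ger0_norm xa4).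
have := vc 1 (normr1 _); have := vc (-1) (normrN1 _); nra.
Qed.

Section LinearCombination.
Context {R : realType} {n : nat} {V : lmodType R} (z : 'I_n -> V).

Definition lincomb (x : 'rV[R]_n) : V := \sum_i x ord0 i *: z i.

Lemma lincomb_linear : linear lincomb.
Proof.
move=> a x y; rewrite /lincomb scaler_sumr -big_split; apply: eq_bigr => i _.
by rewrite !mxE scalerDl scalerA.
Qed.

HB.instance Definition _ :=
  GRing.isLinear.Build R 'rV[R]_n V *:%R lincomb lincomb_linear.

End LinearCombination.

Lemma linear_lincomb (R : realType) (n : nat) (V : lmodType R)
    (f : {linear 'rV[R]_n -> V}) x :
  f x = \sum_i x ord0 i *: f (delta_mx ord0 i).
Proof.
rewrite [in LHS](row_sum_delta x) linear_sum; apply: eq_bigr => i _.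
exact: linearZ.
Qed.

Lemma rV_sphere_compact (R : realType) (n : nat) :
  compact [set x : 'rV[R]_n | `|x| = 1].
Proof.
apply: bounded_closed_compact.
  by exists 1; split => // M M1 x /= ->; exact: ltW.
rewrite (_ : mkset _ = [set x : 'rV[R]_n | `|x| <= 1] `&`
    [set x : 'rV[R]_n | 1 <= `|x|]).
  by apply: closedI; [apply: closed_le_continuous|apply: closed_ge_continuous];
    exact: norm_continuous.
apply/seteqP; split => x /=; first by move=> ->.
by move=> [? ?]; apply/eqP; rewrite eq_le; apply/andP.
Qed.

Lemma delta_combination (R : realType) (n : nat) (V : lmodType R)
    (y : 'I_n -> V) i :
  \sum_k (delta_mx ord0 i : 'rV[R]_n) ord0 k *: y k = y i.
Proof.
rewrite (bigD1 i)//= mxE !eqxx scale1r big1 ?addr0// => k /negPf ki.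
by rewrite mxE ki scale0r.
Qed.

(** * The hyperplane sum property and the Bishop-Phelps-Bollobás property of L1 *)

Lemma L1_AHSp (R : realType) : exists gamma : R -> R,
  forall d (T : measurableType d) (mu : {measure set T -> \bar R}),
    AHSp_linfty4_with gamma (L1 mu).
Proof.
pose P (A : {set 'I_4}) (e g : R) :=
  forall d (T : measurableType d) (mu : {measure set T -> \bar R})
    (y : 'I_4 -> L1 mu), M4 y -> A != finset.set0 ->
    (exists ystar : {linear L1 mu -> R^o}, unit_operator ystar /\
       forall i, i \in A -> ystar (y i) > 1 - g) ->
    exists z : 'I_4 -> L1 mu,
    [/\ M4 z, (forall i, `|z i - y i| < e) & `|\sum_(i in A) z i| = #|A|%:R].
have Pmono A e g g' : g' <= g -> P A e g -> P A e g'.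
  move=> g'g PA d T mu y My A0 [ystar [ystar1 yA]]; apply: PA => //.
  by exists ystar; split => // i /yA; apply: le_lt_trans; rewrite lerB.
have exP A (e : R) : 0 < e < 1 -> exists2 g, 0 < g & P A e g.
  move=> /andP[e0 _].
  pose Phi : seq 'rV[R]_4 :=
    [seq delta_mx ord0 i | i <- enum 'I_4] ++
    [seq delta_mx ord0 t.1.1 - delta_mx ord0 t.1.2 + delta_mx ord0 t.2
       | t : 'I_4 * 'I_4 * 'I_4 <- enum {: 'I_4 * 'I_4 * 'I_4}
       & (t.1.1 < t.1.2 < t.2)%N].
  (* The average over [A]: norm 1 at [xA], together with the bounds [|z i| <= 1], forces the sum
     over [A] to have norm [#|A|]. The compact set of allowed directions is the singleton of [xA],
     so only the vectors move. *)
  pose xA : 'rV[R]_4 := \row_i if i \in A then #|A|%:R^-1 else 0.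
  have tripE (V : lmodType R) (y : 'I_4 -> V) i1 i2 i3 :
      \sum_i (delta_mx ord0 i1 - delta_mx ord0 i2 + delta_mx ord0 i3 : 'rV[R]_4)
        ord0 i *: y i =
      y i1 - y i2 + y i3.
    rewrite -[in RHS](delta_combination y i1) -[in RHS](delta_combination y i2).
    rewrite -[in RHS](delta_combination y i3) -sumrB -big_split/=.
    by apply: eq_bigr => i _; rewrite -scalerBl -scalerDl !mxE.
  have xAE (V : lmodType R) (y : 'I_4 -> V) :
      \sum_i xA ord0 i *: y i = #|A|%:R^-1 *: \sum_(i in A) y i.
    rewrite scaler_sumr [RHS]big_mkcond/=; apply: eq_bigr => i _.
    by rewrite mxE; case: ifP => // _; rewrite scale0r.
  have M4Phi (V : normedModType R) (y : 'I_4 -> V) : M4 y <->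
      forall u, u \in Phi -> `|\sum_i u ord0 i *: y i| <= 1.
    split=> [[y1 y3] u|yPhi].
      rewrite mem_cat => /orP[/mapP[i _ ->]|/mapP[[[i1 i2] i3]]].
        by rewrite delta_combination.
      by rewrite mem_filter => /andP[/= i123 _ ->]; rewrite tripE; exact: y3.
    split=> [i|i1 i2 i3 i123].
      rewrite -(delta_combination y i); apply: yPhi.
      by rewrite mem_cat map_f ?mem_enum.
    rewrite -tripE; apply: yPhi; rewrite mem_cat; apply/orP; right.
    by apply/mapP; exists (i1, i2, i3) => //; rewrite mem_filter mem_enum i123.
  have [g g0 gP] := L1_perturbation Phi (@compact_set1 _ xA) e0.
  exists g => // d T mu y My A0 [ystar [ystar1 yA]].
  have A1 : 0 < #|A|%:R :> R by rewrite ltr0n card_gt0.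
  have sumA : 1 - g < `|\sum_i xA ord0 i *: y i|.
    rewrite xAE normrZ gtr0_norm ?invr_gt0// ltr_pdivlMl//.
    apply: lt_le_trans (unit_operator_le ystar1 _).
    apply: lt_le_trans (ler_norm _).
    rewrite linear_sum mulr_natl -sumr_const; apply: ltr_sum => //.
    by have /set0Pn[a aA] := A0; apply/hasP; exists a; rewrite ?mem_index_enum.
  have /M4Phi yPhi := My.
  have [z [x' [-> zPhi xz zy _]]] := gP _ _ _ y xA erefl My.1 yPhi sumA.
  have Mz : M4 z by apply/M4Phi.
  exists z; split => //; apply/eqP; rewrite eq_le; apply/andP; split.
    apply: le_trans (ler_norm_sum _ _ _) _; rewrite -sumr_const.
    by apply: ler_sum => i _; exact: Mz.1.
  by move: xz; rewrite xAE normrZ gtr0_norm ?invr_gt0// ler_pdivlMl// mulr1.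
have [||gamma [gadm gP]] := @exists_admissible _ (fun e g => forall A, P A e g).
- move=> e e01.
  have /choice[g gP] A : exists g, 0 < g /\ P A e g.
    by have [g g0 Pg] := exP A e e01; exists g.
  (* There are finitely many [A], so one positive threshold serves them all. *)
  exists (\big[Num.min/1]_A g A).
    by apply: lt_bigmin => // A _; have [] := gP A.
  move=> A; apply: Pmono (proj2 (gP A)).
  exact: bigmin_le.
- by move=> e g g' g'g Pg A; exact: Pmono (Pg A).
exists gamma => d T mu; split => // e e01 y My A A0 yA.
exact: (gP e e01 A d T mu y My A0 yA).
Qed.

Lemma L1_BPBp (R : realType) : exists eta : R -> R,
  forall d (T : measurableType d) (mu : {measure set T -> \bar R}),
    BPBp_with eta (linfty4 R) (L1 mu).
Proof.
pose P (e g : R) :=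
  forall d (Omega : measurableType d) (mu : {measure set Omega -> \bar R})
    (T : {linear linfty4 R -> L1 mu}) (x0 : linfty4 R),
    unit_operator T -> `|x0| = 1 -> `|T x0| > 1 - g ->
    exists (u0 : linfty4 R) (S : {linear linfty4 R -> L1 mu}),
    [/\ `|u0| = 1, unit_operator S, `|S u0| = 1,
        `|u0 - x0| < e & opnorm (S \- T) < e].
have [||eta [etaadm etaP]] := @exists_admissible _ P; last first.
- exists eta => d Omega mu; split => // e e01 T x0 T1 x01 Tx0.
  exact: (etaP e e01 d Omega mu T x0 T1 x01 Tx0).
- move=> e g g' g'g Pg d Omega mu T x0 T1 x01 Tx0; apply: Pg => //.
  by apply: le_lt_trans Tx0; rewrite lerB.
move=> e /andP[e0 _].
(* The vertices of the cube: by [cube_norm_le], the constraints of [Phi] say that the operator has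
   norm at most 1. Here the direction [x0] may move too, within the unit sphere. *)
pose Phi : seq 'rV[R]_4 :=
  [seq \row_i (if s i then 1 else -1)
    | s : {ffun 'I_4 -> bool} <- enum {: {ffun 'I_4 -> bool}}].
(* Four coordinates, each off by at most [e / 8], give operator distance at most [e / 2]; the slack
   keeps the inequality strict after the supremum. *)
have e8 : 0 < e / 8 by lra.
have [g g0 gP] := L1_perturbation Phi (@rV_sphere_compact R 4) e8.
exists g => // d Omega mu T x0 T1 x01 Tx0.
pose y i := T (delta_mx ord0 i).
have Ty x : T x = \sum_i x ord0 i *: y i by exact: linear_lincomb.
have norm_le1 (v : 'rV[R]_4) : (forall i, `|v ord0 i| <= 1) -> `|T v| <= 1.
  by move=> v1; apply: le_trans (unit_operator_le T1 v) _; exact: rV_norm_le.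
have [i|u||z [u0 [/= u01 zPhi zu0 zy u0x0]]] := gP _ _ _ y x0 x01.
- apply: norm_le1 => k; rewrite mxE normr_nat.
  by rewrite lern1 leq_b1.
- move=> /mapP[s _ ->]; rewrite -Ty; apply: norm_le1 => i.
  by rewrite mxE; case: (s i); rewrite ?normrN normr1.
- by rewrite -Ty.
have S1 (x : linfty4 R) : `|x| <= 1 -> `|lincomb z x| <= 1.
  apply: cube_norm_le => u u1; apply: zPhi.
  apply/mapP; exists [ffun i => u ord0 i == 1]; first by rewrite mem_enum.
  apply/rowP => i; rewrite mxE ffunE; case: eqVneq => [//|ui].
  have := u1 i; case: ler0P => _; last by move=> /eqP; rewrite (negPf ui).
  by move=> <-; rewrite opprK.
have Su0 : `|lincomb z u0| = 1.
  by apply/eqP; rewrite eq_le zu0 S1// u01.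
exists u0, (lincomb z); split => //.
- by apply: unit_operator_attained S1 _ Su0; rewrite u01.
- by apply: lt_le_trans u0x0 _; lra.
apply: (@le_lt_trans _ _ (e / 2)); last by lra.
apply: opnorm_le => x x1.
rewrite [X in `|X|](_ : _ = \sum_i x ord0 i *: (z i - y i)); last first.
  by under [RHS]eq_bigr do rewrite scalerBr; rewrite sumrB -Ty.
apply: le_trans (ler_norm_sum _ _ _) _.
apply: (@le_trans _ _ (\sum_(i < 4) e / 8)); last first.
  by rewrite sumr_const card_ord -mulr_natl; lra.
apply: ler_sum => i _; rewrite normrZ -[leRHS]mul1r ler_pM//; last exact/ltW.
by apply: le_trans x1; exact: rV_coord_le.
Qed.

Theorem corollary4p8 (R : realType) :
  (exists gamma : R -> R,
     forall (d : measure_display) (T : measurableType d)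
            (mu : {measure set T -> \bar R}),
       AHSp_linfty4_with gamma (L1 mu)) /\
  (forall (d : measure_display) (T : measurableType d)
          (mu : {measure set T -> \bar R}),
     BPBp (linfty4 R) (L1 mu)) /\
  (exists eta : R -> R,
     forall (d : measure_display) (T : measurableType d)
            (mu : {measure set T -> \bar R}),
       BPBp_with eta (linfty4 R) (L1 mu)).
Proof.
have [eta etaP] := L1_BPBp R; split; first exact: L1_AHSp.
by split; [move=> d T mu; exists eta; exact: etaP|exists eta; exact: etaP].
Qed.
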